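(* Fix $n\ge 1$. Consider the standard box-ball system with $n$ balls, and let $s$ be any state and $T(s)$ the state obtained from $s$ by one step of time evolution. Let $(P(s),Q(s))$ denote the pair of tableaux attached to $s$ by the RSK correspondence. Then: (1) $P(T(s))=P(s)$, i.e. the $P$-symbol is a conserved quantity of the time evolution; (2) the $Q$-symbol evolves independently of the $P$-symbol: for any two states $s_1,s_2$ with $Q(s_1)=Q(s_2)$ one has $Q(T(s_1))=Q(T(s_2))$.
   Context: Standard box-ball system (BBS): boxes are indexed by $\mathbf{Z}$, each box has capacity one, and there are $n$ balls of $n$ distinct colors $1,2,\dots,n$. A state is an assignment of the $n$ balls to $n$ distinct boxes; equivalently a sequence $(a_i)_{i\in\mathbf{Z}}$ with $a_i\in\{1,\dots,n,e\}$, where $e=n+1$ denotes an empty box, in which each color $1,\dots,n$ occurs exactly once. One step of time evolution: every ball is moved exactly once; first the ball of color $1$ is moved to the nearest empty box to its right, then the ball of color $2$ is moved to the nearest empty box to its right (in the configuration after color 1 has moved), and so on for colors $3,\dots,n$ in this order. Bi-word of a state: list the occupied boxes $i_1<i_2<\dots<i_n$ and form the two-rowed array with top row $i_1,\dots,i_n$ and bottom row $a_{i_1},\dots,a_{i_n}$. RSK: the $P$-symbol is the tableau obtained by successively row-inserting (Schensted bumping) $a_{i_1},a_{i_2},\dots,a_{i_n}$ into the empty tableau; the $Q$-symbol is the tableau of the same shape obtained by writing $i_k$ in the box newly created when $a_{i_k}$ is inserted. Row insertion of $x$ into a tableau: if no entry of the first row is larger than $x$, append $x$ to the end of the row; otherwise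 replace the leftmost entry larger than $x$ by $x$ and insert the replaced entry into the next row in the same way. *)

(* Defs.v *)
From HB Require Import structures.
From mathcomp Require Import all_boot all_order all_algebra.

Set Implicit Arguments.
Unset Strict Implicit.
Unset Printing Implicit Defensive.

Import Order.TTheory GRing.Theory Num.Theory.

(* An assignment of the n balls to n distinct boxes: [box_of s c] is the box  *)
(* containing the ball of color [c.+1].                                       *)
Record state (n : nat) := State {
  box_of :> {ffun 'I_n -> int};
  box_of_inj : injectiveb box_of
}.

HB.instance Definition _ n := [isSub for @box_of n].
HB.instance Definition _ n := [Equality of state n by <:].

Definition occupied n (s : state n) (i : int) : bool := i \in codom s.

(* The entry a_i in {1, ..., n+1} of the sequence form of the state; since    *)
(* [index] returns n on a box that is not listed, an empty box gets e = n+1.  *)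
Definition color_at n (s : state n) (i : int) : nat := (index i (codom s)).+1.

Lemma color_at_box n (s : state n) (c : 'I_n) : color_at s (s c) = c.+1.
Proof.
rewrite /color_at codomE index_map ?index_enum_ord //.
exact/injectiveP/box_of_inj.
Qed.

Lemma color_at_empty n (s : state n) i :
  ~~ occupied s i -> color_at s i = n.+1.
Proof. by move=> iNs; rewrite /color_at memNindex // size_codom card_ord. Qed.

Lemma exists_empty_right n (s : state n) (i : int) :
  exists k : nat, (0 < k) && ~~ occupied s (i + k%:Z)%R.
Proof.
case: (boolP (has (fun k : nat => ~~ occupied s (i + k%:Z)%R) (iota 1 n.+1))).
  by case/hasP=> k; rewrite mem_iota => /andP[k_gt0 _] kP; exists k; rewrite k_gt0.
rewrite -all_predC => /allP occ.
have : size [seq (i + k%:Z)%R | k : nat <- iota 1 n.+1] <= size (codom s).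
  apply: uniq_leq_size.
    rewrite map_inj_uniq ?iota_uniq // => k l /addrI; exact: (can_inj absz_nat).
  by move=> _ /mapP[k /occ /negbNE ? ->].
by rewrite size_map size_iota size_codom card_ord ltnn.
Qed.

Definition nearest_empty n (s : state n) (i : int) : int :=
  (i + (ex_minn (exists_empty_right s i))%:Z)%R.

Lemma nearest_emptyP n (s : state n) (i : int) :
  [/\ (i < nearest_empty s i)%R, ~~ occupied s (nearest_empty s i)
    & forall j : int, (i < j < nearest_empty s i)%R -> occupied s j].
Proof.
rewrite /nearest_empty; case: ex_minnP => k /andP[k_gt0 kN] kmin.
split=> // [|j /andP[ij jk]]; first by rewrite ltrDl ltz_nat.
apply: contraT => jN.
have dE : (j - i = `|j - i|%N%:Z)%R by rewrite gez0_abs // subr_ge0 ltW.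
have := kmin `|j - i|%N; rewrite -dE subrKC jN andbT -ltz_nat -dE subr_gt0.
by move=> /(_ ij); rewrite -lez_nat -dE lerBrDl leNgt jk.
Qed.

Definition move_fun n (s : state n) (c : 'I_n) : {ffun 'I_n -> int} :=
  [ffun d => if d == c then nearest_empty s (s c) else s d].

Lemma move_fun_inj n (s : state n) (c : 'I_n) : injectiveb (move_fun s c).
Proof.
have s_inj : injective s by exact/injectiveP/box_of_inj.
have [_ /negP eN _] := nearest_emptyP s (s c).
apply/injectiveP=> d d'; rewrite !ffunE.
case: eqP => [->|_]; case: eqP => [->|_] //; last exact: s_inj.
- by move=> E; case: eN; rewrite /occupied E codom_f.
- by move=> E; case: eN; rewrite /occupied -E codom_f.
Qed.

Definition move n (s : state n) (c : 'I_n) : state n := State (move_fun_inj s c).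

(* [enum 'I_n] is increasing, so the colors move in the order 1, ..., n. *)
Definition bbs_step n (s : state n) : state n := foldl (@move n) s (enum 'I_n).

Definition biword n (s : state n) : seq (int * nat) :=
  [seq (i, color_at s i) | i <- sort (fun i j : int => (i <= j)%R) (codom s)].

(* Tableaux are given by their sequences of rows, first row first. *)
Definition tableau (A : Type) := seq (seq A).

(* The second component is the bumped entry, if any. *)
Definition row_insert (x : nat) (r : seq nat) : seq nat * option nat :=
  let k := find (fun y => x < y) r in
  if k < size r then (set_nth 0 r k x, Some (nth 0 r k)) else (rcons r x, None).

(* The second component is the index of the row where the new box, which is   *)
(* always the last one of its row, is created.                                *)
Fixpoint tab_insert (x : nat) (t : tableau nat) : tableau nat * nat :=
  if t is r :: t' then
    match row_insert x r with
    | (r', None) => (r' :: t', 0)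
    | (r', Some y) => let: (t'', k) := tab_insert y t' in (r' :: t'', k.+1)
    end
  else ([:: [:: x]], 0).

Definition add_box (A : Type) (q : tableau A) (k : nat) (i : A) : tableau A :=
  set_nth [::] q k (rcons (nth [::] q k) i).

Definition rsk_step (pq : tableau nat * tableau int) (ia : int * nat) :
    tableau nat * tableau int :=
  let: (p, k) := tab_insert ia.2 pq.1 in (p, add_box pq.2 k ia.1).

Definition rsk (w : seq (int * nat)) : tableau nat * tableau int :=
  foldl rsk_step ([::], [::]) w.

Definition P_symbol n (s : state n) : tableau nat := (rsk (biword s)).1.
Definition Q_symbol n (s : state n) : tableau int := (rsk (biword s)).2.

(* Main.v *)
(* By the symmetry of RSK, the Q-symbol of a state is, up to the names of the
   boxes, the insertion tableau of the word p of the boxes of the balls 1, ..., n.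
   Moving the balls one after the other amounts to row-inserting the word p into
   the row of all empty boxes, the bumped word being the word of the new boxes.
   Row insertion of Knuth equivalent words bumps Knuth equivalent words, so the
   new Q-symbol depends only on the old one.
   The local rule for row insertion is symmetric in time and entry. Reading the
   same insertion along the boxes instead of the colors gives a carrier that
   travels to the right, swaps colors by row insertion and drops its first ball in
   each empty box; hence (colors read) ~ (colors written) (carrier) in the plactic
   monoid. The carrier ends up empty, so the color word keeps its Knuth class and
   the P-symbol is preserved. The same symmetry, applied to one row at a time,
   proves the symmetry of RSK. *)

Require Import Defs.
From mathcomp Require Import all_boot all_order all_algebra.
From mathcomp Require Import zify.

Set Implicit Arguments.
Unset Strict Implicit.
Unset Printing Implicit Defensive.

(** * Row insertion and Knuth equivalence *)

Arguments row_insert : simpl never.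

Lemma row_insert_nil x : row_insert x [::] = ([:: x], None).
Proof. by []. Qed.

Lemma row_insert_cons x a r : row_insert x (a :: r) =
  if x < a then (x :: r, Some a)
  else let: (r', o) := row_insert x r in (a :: r', o).
Proof.
rewrite /row_insert /=; case: (x < a) => //=.
by set k := find _ r; rewrite -[(k.+1 < _)%N]/(k < size r)%N; case: ifP.
Qed.

Fixpoint row_run (r w : seq nat) : seq nat * seq nat :=
  if w is x :: w' then
    let: (r1, o) := row_insert x r in
    let: (r2, v) := row_run r1 w' in (r2, seq_of_opt o ++ v)
  else (r, [::]).

Lemma row_run_cat r u v : row_run r (u ++ v) =
  let: (r1, u') := row_run r u in
  let: (r2, v') := row_run r1 v in (r2, u' ++ v').
Proof.
elim: u r => [|x u IH] r /=; first by case: row_run.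
case: row_insert => r1 o; rewrite IH; case: row_run => r2 u'.
by case: row_run => r3 v'; rewrite catA.
Qed.

Definition tab_of (w : seq nat) : tableau nat :=
  foldl (fun t x => (tab_insert x t).1) [::] w.

Lemma foldl_tab_insert r t w :
  foldl (fun t x => (tab_insert x t).1) (r :: t) w =
  let: (r', w') := row_run r w in
  r' :: foldl (fun t x => (tab_insert x t).1) t w'.
Proof.
elim: w r t => [|x w IH] r t //=.
case: (row_insert x r) => r1 [y|] /=.
  case E: (tab_insert y t) => [t' k] /=; rewrite IH.
  by case: row_run => r2 w' /=; rewrite E.
by rewrite IH; case: row_run.
Qed.

Lemma tab_of_row_run w : w != [::] ->
  tab_of w = (row_run [::] w).1 :: tab_of (row_run [::] w).2.
Proof.
case: w => // x w _; rewrite /tab_of /= foldl_tab_insert.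
by case: row_run.
Qed.

(** The plactic congruence. The mix of strict and weak inequalities is the one for words with
    repeated letters and matches bumping the leftmost strictly larger entry. *)
Inductive knuth : seq nat -> seq nat -> Prop :=
| knuth_refl u : knuth u u
| knuth_sym u v : knuth u v -> knuth v u
| knuth_trans v u w : knuth u v -> knuth v w -> knuth u w
| knuth_cat u u' v v' : knuth u u' -> knuth v v' -> knuth (u ++ v) (u' ++ v')
| knuth_yxz x y z : x < y <= z -> knuth [:: y; x; z] [:: y; z; x]
| knuth_xzy x y z : x <= y < z -> knuth [:: x; z; y] [:: z; x; y].

Lemma knuth_catl u v v' : knuth v v' -> knuth (u ++ v) (u ++ v').
Proof. exact/knuth_cat/knuth_refl. Qed.

Lemma knuth_catr v u u' : knuth u u' -> knuth (u ++ v) (u' ++ v).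
Proof. by move=> ?; apply: knuth_cat => //; apply: knuth_refl. Qed.

Lemma knuth_perm u v : knuth u v -> perm_eq u v.
Proof.
elim=> {u v} //.
- by move=> u v _; rewrite perm_sym.
- by move=> v u w _ uv _; apply: perm_trans.
- by move=> u u' v v' _ + _; apply: perm_cat.
- by move=> x y z _; rewrite perm_cons (perm_catC [:: x] [:: z]).
- by move=> x y z _; rewrite (perm_catCA [:: x] [:: z] [:: y]).
Qed.

(** * Bumping in a single row and the Knuth relations *)

Lemma row_insert_path x r a : path leq a r -> a <= x ->
  path leq a (row_insert x r).1.
Proof.
elim: r a => [|b r IH] a /=; first by move=> _ ->.
case/andP=> ab br ax; rewrite row_insert_cons; case: ltnP => [xb|bx] /=.
  by rewrite ax /=; case: r br {IH} => //= c r /andP[bc ->]; rewrite andbT; lia.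
by have := IH b br bx; case: row_insert => r' o /=; rewrite ab.
Qed.

Lemma row_insert_sorted x r : sorted leq r -> sorted leq (row_insert x r).1.
Proof.
move=> r_s; apply: (@path_sorted _ _ 0); apply: row_insert_path => //.
by case: r r_s.
Qed.

Lemma row_run_sorted w r : sorted leq r -> sorted leq (row_run r w).1.
Proof.
elim: w r => //= x w IH r r_s; have := row_insert_sorted x r_s.
by case: row_insert => r1 o /= /IH; case: row_run.
Qed.

Lemma bumped_ge x r a y : path leq a r -> (row_insert x r).2 = Some y ->
  maxn a x.+1 <= y.
Proof.
elim: r a => [|b r IH] a //= /andP[ab br]; rewrite row_insert_cons.
case: ltnP => [xb [<-]|bx]; first by lia.
by have := IH b br; case: row_insert => r' o /= /[apply]; lia.
Qed.

(** Row bumping lemma: [z] lands strictly to the right of the place of [y]. *)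
Lemma bumped_weakly_increasing r y z : sorted leq r -> y <= z ->
  let: (r1, o) := row_insert y r in
  match o, (row_insert z r1).2 with
  | None, Some _ => false
  | Some a, Some b => a <= b
  | _, _ => true
  end.
Proof.
move=> + yz; elim: r => [|b r IH] r_s.
  by rewrite row_insert_nil row_insert_cons ltnNge yz.
rewrite row_insert_cons; case: ltnP => [yb|by_].
  rewrite row_insert_cons ltnNge yz /=.
  have := @bumped_ge z r b; case: row_insert => r' [o|] //= /(_ _ r_s erefl).
  by lia.
have := IH (path_sorted r_s); case: row_insert => r1 o.
rewrite row_insert_cons ltnNge (leq_trans by_ yz) /=.
by case: (row_insert z r1).
Qed.

(** Once inserted, [z] has only entries at most [z] on its left, so [y] bumps [z] or one of
    these. *)
Lemma bumped_strictly_decreasing r y z : y < z ->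
  let: (r1, o) := row_insert z r in
  exists2 b, (row_insert y r1).2 = Some b & b <= z.
Proof.
move=> yz; elim: r => [|b r IH].
  by rewrite row_insert_nil row_insert_cons yz; exists z.
rewrite row_insert_cons; case: ltnP => [zb|bz].
  by rewrite row_insert_cons yz; exists z.
move: IH; case: row_insert => r1 o [c E cz].
rewrite row_insert_cons; case: ltnP => yb; first by exists b.
by exists c => //; move: E; case: row_insert.
Qed.

(** Compare the head [a] with the letters: if [a <= x], all three pass on to the tail; if
    [x < a <= y], only [x] stops at the head; otherwise [y] and then [x] stop there. The bumped
    words are equal or again Knuth related. *)
Lemma row_run_yxz x y z r : x < y <= z -> sorted leq r ->
  (row_run r [:: y; x; z]).1 = (row_run r [:: y; z; x]).1 /\
  knuth (row_run r [:: y; x; z]).2 (row_run r [:: y; z; x]).2.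
Proof.
case/andP=> xy yz; elim: r => [|a r IH] r_s.
  rewrite /= !row_insert_cons xy (ltnNge z) yz /=.
  rewrite !row_insert_cons xy ltnNge (leq_trans (ltnW xy) yz) /=.
  by split=> //; apply: knuth_refl.
have [ax|xa] := leqP a x.
  have [] := IH (path_sorted r_s); rewrite /= !row_insert_cons !ltnNge.
  rewrite !(leq_trans ax) ?(ltnW (leq_trans xy yz)) ?(ltnW xy) //=.
  case: (row_insert y r) => r1 o1; rewrite !row_insert_cons !ltnNge.
  rewrite !(leq_trans ax) ?(ltnW (leq_trans xy yz)) //=.
  case: (row_insert x r1) => r2 o2; rewrite !row_insert_cons !ltnNge.
  rewrite !(leq_trans ax) ?(ltnW (leq_trans xy yz)) //=.
  case: (row_insert z r2) => r3 o3.
  case: (row_insert z r1) => r4 o4; rewrite !row_insert_cons !ltnNge ax /=.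
  by case: (row_insert x r4) => r5 o5 /= -> ?.
have [ay|ya] := leqP a y.
  have := bumped_weakly_increasing (path_sorted r_s) yz.
  have := @bumped_ge y r a.
  rewrite /= !row_insert_cons (ltnNge y) ay /=.
  case: (row_insert y r) => r1 o1 /=; rewrite !row_insert_cons xa.
  rewrite ltnNge (leq_trans ay yz) /= row_insert_cons.
  rewrite ltnNge (leq_trans (ltnW xy) yz) /=.
  case: (row_insert z r1) => r2 o2; rewrite row_insert_cons xa /=.
  case: o1 o2 => [b|] [c|] //= b_ge; try by split=> //; apply: knuth_refl.
  move=> bc; split=> //; apply: knuth_yxz; have := b_ge _ r_s erefl; lia.
have := @bumped_ge z r a.
rewrite /= !row_insert_cons ya !row_insert_cons xy.
rewrite (ltnNge z) yz /= row_insert_cons ltnNge (leq_trans (ltnW xy) yz) /=.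
case: (row_insert z r) => r1 o1 /=; rewrite row_insert_cons xy /=.
case: o1 => [b|] b_ge; last by split=> //; apply: knuth_refl.
split=> //; apply: (knuth_yxz (x := y) (y := a) (z := b)).
by have := b_ge _ r_s erefl; lia.
Qed.

Lemma row_run_xzy x y z r : x <= y < z -> sorted leq r ->
  (row_run r [:: x; z; y]).1 = (row_run r [:: z; x; y]).1 /\
  knuth (row_run r [:: x; z; y]).2 (row_run r [:: z; x; y]).2.
Proof.
case/andP=> xy yz; have xz := leq_ltn_trans xy yz.
elim: r => [|a r IH] r_s.
  rewrite /= !row_insert_cons xz ltnNge (ltnW xz) /=.
  rewrite !row_insert_cons yz (ltnNge y) xy /=.
  by split=> //; apply: knuth_refl.
have [ax|xa] := leqP a x.
  have [] := IH (path_sorted r_s); rewrite /= !row_insert_cons !ltnNge.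
  rewrite !(leq_trans ax) ?(ltnW xz) //=.
  case: (row_insert x r) => r1 o1; rewrite !row_insert_cons !ltnNge.
  rewrite !(leq_trans ax) ?(ltnW xz) //=.
  case: (row_insert z r1) => r2 o2; rewrite !row_insert_cons !ltnNge.
  rewrite !(leq_trans ax) //=.
  case: (row_insert y r2) => r3 o3.
  case: (row_insert z r) => r4 o4; rewrite !row_insert_cons !ltnNge ax /=.
  case: (row_insert x r4) => r5 o5; rewrite !row_insert_cons !ltnNge.
  rewrite !(leq_trans ax) //=.
  by case: (row_insert y r5) => r6 o6 /= -> ?.
have [az|za] := leqP a z.
  have := bumped_strictly_decreasing r yz.
  have := @row_insert_path z r a r_s az.
  have := @bumped_ge z r a.
  rewrite /= !row_insert_cons xa (ltnNge z) az /=.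
  rewrite !row_insert_cons ltnNge (ltnW xz) /=.
  case: (row_insert z r) => r1 o1 /=; rewrite !row_insert_cons xa.
  rewrite ltnNge xy /= row_insert_cons ltnNge xy /= => z_ge r1_s.
  have := @bumped_ge y r1 a; case: (row_insert y r1) => r2 o2 /= y_ge [b o2E bz].
  rewrite {}o2E in y_ge *.
  case: o1 z_ge => [c|] z_ge /=; split=> //; last exact: knuth_refl.
  apply: knuth_xzy.
  by have := z_ge _ r_s erefl; have := y_ge _ r1_s erefl; lia.
rewrite /= !row_insert_cons xa za !row_insert_cons xz ltnNge (ltnW xz) /=.
case: r r_s {IH} => [|b r] r_s.
  rewrite row_insert_nil !row_insert_cons yz (ltnNge y) xy /=.
  by split=> //; apply: knuth_refl.
have zb : z < b by case/andP: r_s; lia.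
(* Both orders bump [a] first, then [b] and [z] in opposite orders, so here the bumped words differ
   by the other Knuth relation. *)
rewrite !row_insert_cons zb (ltn_trans yz zb) (ltnNge y x) xy /=.
rewrite !row_insert_cons yz (ltnNge y x) xy /=; split=> //; apply: knuth_sym.
by apply: knuth_yxz; case/andP: r_s; lia.
Qed.

(** The starting row is arbitrary: the empty row gives the invariance of the tableau, the row of
    empty boxes gives the evolution of the Q-symbol. *)
Lemma knuth_row_run u v r : knuth u v -> sorted leq r ->
  (row_run r u).1 = (row_run r v).1 /\
  knuth (row_run r u).2 (row_run r v).2.
Proof.
move=> uv; elim: uv r => {u v}.
- by move=> u r _; split=> //; apply: knuth_refl.
- by move=> u v _ IH r /IH[-> ?]; split=> //; apply: knuth_sym.
- by move=> v u w _ IH _ IH' r r_s; have [-> /knuth_trans +] := IH r r_s;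
    have [-> +] := IH' r r_s => /[swap] /[apply].
- move=> u u' v v' _ IH _ IH' r r_s; rewrite !row_run_cat.
  have := row_run_sorted u r_s; have := IH r r_s.
  case: (row_run r u) (row_run r u') => [r1 u1] [r1' u1'] /= [<- u1u1'].
  move=> /IH'; case: (row_run r1 v) (row_run r1 v') => r2 v1 [r2' v1'] /=.
  by move=> [-> v1v1']; split=> //; apply: knuth_cat.
- by move=> x y z xyz r; apply: row_run_yxz.
- by move=> x y z xyz r; apply: row_run_xzy.
Qed.

(** By Knuth relations the new letter moves left to its place, then the bumped letter moves left to
    the front. *)
Lemma knuth_row_insert x r : sorted leq r ->
  knuth (rcons r x)
    (seq_of_opt (row_insert x r).2 ++ (row_insert x r).1).
Proof.
elim: r => [|a r IH] r_s /=; first exact: knuth_refl.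
rewrite row_insert_cons; case: ltnP => [xa|ax] /=.
  elim: r a xa r_s {IH} => [|b r IH] a xa /=; first by move=> _; apply: knuth_refl.
  case/andP=> ab br.
  have /= /knuth_trans := knuth_catl [:: a] (IH b (leq_trans xa ab) br); apply.
  apply: (@knuth_catr r [:: a; b; x] [:: a; x; b]).
  by apply/knuth_sym/knuth_yxz; rewrite xa.
move: (IH (path_sorted r_s)) (row_insert_path r_s ax).
have := @bumped_ge x r a.
case E : (row_insert x r) => [r' [y|]] /= y_ge; last first.
  by move=> rx _; apply: (@knuth_catl [:: a]).
move=> /(knuth_catl [:: a])/knuth_trans rx r'_s; apply: rx; move: r'_s.
case: r' E => [|b r' E /andP[ab _]].
  case: r r_s {IH y_ge} => [|c r] _; rewrite ?row_insert_cons //.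
  by case: ifP => //; case: row_insert.
(* The bumped [y] passes the head [a] because the new tail starts with some [b] such that
   [a <= b < y]. *)
apply: (@knuth_catr r' [:: a; y; b] [:: y; a; b]); apply: knuth_xzy.
rewrite ab /=; have {y_ge} := y_ge y r_s erefl; case: r E {IH r_s} => //= c r.
rewrite row_insert_cons; case: ltnP => cx; last case: row_insert => ? ?.
  by move=> [<- _ <-].
by move=> [<- _ _]; lia.
Qed.

Lemma knuth_row_run_cat r w : sorted leq r ->
  knuth (r ++ w) ((row_run r w).2 ++ (row_run r w).1).
Proof.
elim: w r => [|x w IH] r r_s /=; first by rewrite cats0; apply: knuth_refl.
have := knuth_row_insert x r_s; have := row_insert_sorted x r_s.
case: row_insert => r1 o /= /IH; case: row_run => r2 v /= IH1 rx.
rewrite -cat_rcons; apply: knuth_trans (knuth_catr w rx) _.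
by rewrite -!catA; apply: knuth_catl.
Qed.

(** Induction on the number of rows. Congruent words leave the same first row and bump congruent
    words; conversely a word is congruent to its bumped word followed by its first row, so the
    tableau determines the class. *)
Theorem knuth_tab_of u v : knuth u v <-> tab_of u = tab_of v.
Proof.
have nil_tab w : tab_of w = [::] -> w = [::].
  by case: (eqVneq w [::]) => // /tab_of_row_run ->.
split.
  elim: {u}_.+1 {-2}u v (ltnSn (size (tab_of u))) => // m IH u v size_u uv.
  have [u0|u_neq0] := eqVneq u [::].
    by move: (perm_size (knuth_perm uv)); rewrite u0; case: v {uv}.
  have v_neq0 : v != [::].
    by move: (perm_size (knuth_perm uv)) u_neq0; case: u {uv size_u}; case: v.
  have [row_uv bump_uv] := @knuth_row_run u v [::] uv isT.
  move: size_u; rewrite (tab_of_row_run u_neq0) (tab_of_row_run v_neq0) row_uv ltnS => size_u.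
  by congr (_ :: _); apply: IH.
elim: {u}_.+1 {-2}u v (ltnSn (size (tab_of u))) => // m IH u v size_u uv.
have [u0|u_neq0] := eqVneq u [::].
  by move: uv; rewrite u0 => /esym /nil_tab ->; apply: knuth_refl.
have [v0|v_neq0] := eqVneq v [::].
  by move: uv; rewrite v0 => /nil_tab ->; apply: knuth_refl.
move: uv size_u; rewrite (tab_of_row_run u_neq0) (tab_of_row_run v_neq0) => -[row_uv bump_uv] size_u.
apply: knuth_trans (@knuth_row_run_cat [::] u isT) _.
apply/knuth_sym/(knuth_trans (@knuth_row_run_cat [::] v isT))/knuth_sym.
by rewrite row_uv; apply/knuth_catr/IH.
Qed.

(** * The grid of a row insertion *)

(** A strictly increasing row is determined by its set of entries, so insertion can be described by
    membership alone, which is what the grid records. *)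
Lemma row_insertP x r : sorted ltn r -> x \notin r ->
  let: (r', o) := row_insert x r in
  [/\ sorted ltn r',
      forall z, (z \in r') = (z == x) || (z \in r) && (o != Some z)
    & if o is Some y then
        [/\ y \in r, x < y & forall z, z \in r -> z < y -> z < x]
      else forall z, z \in r -> z < x].
Proof.
have path_mem a s : path ltn a s -> forall z, z \in s -> a < z.
  by move=> /(order_path_min ltn_trans) /allP.
elim: r => [|a r IH] r_s; first by rewrite row_insert_nil; split.
rewrite inE negb_or eq_sym => /andP[ax xr]; rewrite row_insert_cons.
case: ltnP => [xa|xa].
  split.
  - by case: r r_s {IH xr} => //= b r /andP[ab ->]; rewrite (ltn_trans xa).
  - move=> z; rewrite !inE; case: (eqVneq z x) => //= _.
    have := path_mem _ _ r_s z; case: (eqVneq z a) => [->|za] /=.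
      by case: (a \in r) => [/(_ isT)|]; rewrite ?ltnn ?eqxx.
    by rewrite (_ : Some a != Some z) ?andbT //; apply: contra za => /eqP[->].
  - split=> //; first exact: mem_head.
    move=> z; rewrite inE => /orP[/eqP->|/(path_mem _ _ r_s)]; lia.
have {}ax : a < x by rewrite ltn_neqAle ax.
have := IH (path_sorted r_s) xr; case: row_insert => r' o [r'_s r'E oP].
split.
- rewrite /= path_min_sorted //; apply/allP=> z; rewrite r'E.
  by case/orP=> [/eqP->//|/andP[/(path_mem _ _ r_s)]].
- move=> z; rewrite !inE r'E; case: (eqVneq z x) => [->|zx]; rewrite ?orbT //=.
  case: (eqVneq z a) => //= za; case: o oP {r'E} => [y [yr _ _]|_] //=.
  by apply/esym/eqP=> -[ya]; have := path_mem _ _ r_s y yr; rewrite ya za ltnn.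
- case: o oP {r'E} => [y [yr xy yP]|P]; first split=> //.
  + by rewrite inE yr orbT.
  + by move=> z; rewrite inE => /orP[/eqP->//|]; apply: yP.
  + by move=> z; rewrite inE => /orP[/eqP->//|]; apply: P.
Qed.

Lemma row_insert_eq x y r r' :
  sorted ltn r -> x \notin r -> y \in r -> x < y ->
  (forall z, z \in r -> x < z -> y <= z) ->
  sorted ltn r' -> (forall z, (z \in r') = (z == x) || (z \in r) && (z != y)) ->
  row_insert x r = (r', Some y).
Proof.
move=> r_s xr yr xy yP r'_s r'E; have := row_insertP r_s xr.
case: row_insert => r1 [y1|] [r1_s r1E]; last by move/(_ y yr); lia.
case=> y1r xy1 y1P.
have yy1 : y1 = y by have := yP _ y1r xy1; have := y1P _ yr; lia.
rewrite {}yy1 in r1E *; congr (_, _).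
apply: (irr_sorted_eq ltn_trans ltnn) => // z; rewrite r1E r'E.
by rewrite (_ : (Some y != Some z) = (z != y)) // eq_sym.
Qed.

(* The flag [b] marks the passage of the carrier at an empty box, where it drops
   its first ball. *)
Definition row_step (b : bool) (o : option nat) (r : seq nat) :
    seq nat * option nat :=
  if o is Some x then row_insert x r
  else if b then (behead r, ohead r) else (r, None).

(** With [b = xpred0] this is plain row insertion; with [b] the set of empty boxes it is the
    carrier. *)
Fixpoint row_at (b : nat -> bool) (g : nat -> option nat) r k : seq nat :=
  if k is k'.+1 then (row_step (b k') (g k') (row_at b g r k')).1 else r.

Definition out_at b g r k : option nat :=
  (row_step (b k) (g k) (row_at b g r k)).2.

(* In a grid of cells (c, k), [H c k] says that k is in the row just before time
   c, and [V c k] that the entry travelling at time c has been inserted and has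
   bumped nothing below k. A line is born at a marked cell ([p]), two lines
   meeting at a cell annihilate there (this is a bump), and any other line goes
   through. Since the rule is symmetric, exchanging H and V exchanges times and
   entries. *)
Definition turn (p a b : bool) := p || a && ~~ b.

Lemma eq_SomeE (T : eqType) (x y : T) : (Some x == Some y) = (x == y).
Proof. by []. Qed.

(** The travelling line [H] is an interval: above the inserted [x] up to the bumped [y], or
    unbounded if nothing is bumped; at an empty box it runs from 0 to the first ball, or forever if
    there is none. All clauses follow by comparing this interval with [r]. *)
Lemma row_stepP (b : bool) (o : option nat) r (H V V' : nat -> bool) :
    sorted ltn r -> (forall c, V c = (c \in r)) ->
    (forall x, o = Some x -> x \notin r) -> (b -> o = None) -> H 0 = b ->
    (forall c, H c.+1 = turn (o == Some c) (H c) (V c)) ->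
    (forall c, V' c = turn (o == Some c) (V c) (H c)) ->
  let: (r', o') := row_step b o r in
  [/\ sorted ltn r', forall c, V' c = (c \in r'),
      forall c, (o' == Some c) = [&& o != Some c, H c & V c]
    & forall m, all (fun c => c < m) r -> all (fun c => c < m) r' ->
        H m = (isSome o || b) && (o' == None)].
Proof.
move=> r_s VE oN bN H0 HS V'E; case: o oN bN HS V'E => [x|] oN bN HS V'E /=.
  have xr := oN x erefl; have {bN} b0 : b = false by case: (b) bN => // /(_ isT).
  rewrite {b}b0 in H0 *; have := row_insertP r_s xr.
  case: row_insert => r' [y|] [r'_s r'E oP].
    case: oP => yr xy yP.
    have HE c : H c = (x < c <= y).
      elim: c => [//|c IHc]; rewrite HS IHc VE /turn.
      rewrite eq_SomeE.
      have := yP c; case: (eqVneq c y) => [->|cy]; first by rewrite yr; lia.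
      by case: (c \in r) => [/(_ isT)|_]; lia.
    split=> //.
    + move=> c; rewrite V'E VE HE r'E /turn.
      rewrite !eq_SomeE (eq_sym x) (eq_sym y).
      case: (eqVneq c x) => //= cx; case: (boolP (c \in r)) => //= cr.
      by have := yP c cr; lia.
    + move=> c; rewrite VE HE.
      rewrite !eq_SomeE (eq_sym x) (eq_sym y).
      case: (eqVneq c y) => [->|cy]; first by rewrite yr xy leqnn neq_ltn xy orbT.
      by case: (boolP (c \in r)) => [/yP|]; rewrite ?andbF //; lia.
    + move=> m /allP/(_ y yr)/= ym _.
      by rewrite HE (_ : x < m <= y = false) //; lia.
  have HE c : H c = (x < c).
    elim: c => [//|c IHc]; rewrite HS IHc VE /turn.
    rewrite eq_SomeE.
    by have := oP c; case: (c \in r) => [/(_ isT)|_]; lia.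
  split=> //.
  + move=> c; rewrite V'E VE HE r'E /turn.
    rewrite eq_SomeE (eq_sym x).
    case: (eqVneq c x) => //= cx; case: (boolP (c \in r)) => //= /oP; lia.
  + move=> c; rewrite VE HE (_ : (x < c) && (c \in r) = false) ?andbF //.
    by case: (boolP (c \in r)) => [/oP|]; lia.
  + by move=> m _ /allP/(_ x); rewrite r'E eqxx HE /= => ->.
case: b bN H0 => [_|_] H0; last first.
  have HE c : H c = false by elim: c => // c IHc; rewrite HS IHc.
  by split=> // [c|c]; rewrite ?V'E ?VE /turn HE ?andbT.
case: r r_s VE oN => [|y r] r_s VE oN /=.
  have HE c : H c = true by elim: c => // c IHc; rewrite HS IHc VE.
  by split=> // c; rewrite ?V'E VE // HE.
have yr : forall z, z \in r -> y < z.
  by move: r_s => /= /(order_path_min ltn_trans) /allP.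
have HE c : H c = (c <= y).
  elim: c => // c IHc; rewrite HS IHc VE inE /turn /=.
  by case: (ltngtP c y) => //= cy; apply/negP => /yr; lia.
split.
- exact: path_sorted r_s.
- move=> c; rewrite V'E VE HE inE /turn /=.
  case: (eqVneq c y) => [->|cy] /=.
    by rewrite leqnn; apply/esym/negP=> /yr; rewrite ltnn.
  by case: (boolP (c \in r)) => //= /yr; lia.
- move=> c; rewrite VE HE inE /= eq_SomeE (eq_sym y).
  case: (eqVneq c y) => [->|cy] /=; first by rewrite leqnn.
  by case: (boolP (c \in r)) => [/yr|]; rewrite ?andbF //; lia.
- by move=> m /andP[ym _] _; rewrite HE (_ : m <= y = false) //; lia.
Qed.

Lemma grid_row_at (b : nat -> bool) (g : nat -> option nat) r (H V : nat -> nat -> bool) :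
    sorted ltn r -> (forall c, V c 0 = (c \in r)) -> (forall k, H 0 k = b k) ->
    (forall c k, H c.+1 k = turn (g k == Some c) (H c k) (V c k)) ->
    (forall c k, V c k.+1 = turn (g k == Some c) (V c k) (H c k)) ->
    (forall k, b k -> g k = None) ->
    (forall k x, g k = Some x -> x \notin r) ->
    (forall k k' x, g k = Some x -> g k' = Some x -> k = k') -> forall k,
  [/\ sorted ltn (row_at b g r k), forall c, V c k = (c \in row_at b g r k),
      forall c, (out_at b g r k == Some c) = [&& g k != Some c, H c k & V c k]
    & forall m, all (fun c => c < m) r -> (forall k x, g k = Some x -> x < m) ->
        H m k = (isSome (g k) || b k) && (out_at b g r k == None)].
Proof.
move=> r_s V0 H0 HS VS bN gN g_inj.
(* Every entry of the row comes from [r] or from an earlier insertion. As [g] avoids [r] and is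
   injective, an inserted entry is never already present. *)
have Vfrom c k : V c k -> c \in r \/ exists2 k', k' < k & g k' = Some c.
  elim: k => [|k IHk]; first by rewrite V0; left.
  rewrite VS /turn => /orP[/eqP gk|/andP[/IHk[cr|[k' k'k gk']] _]].
  - by right; exists k.
  - by left.
  - by right; exists k'; rewrite // ltnW.
have rowP k : sorted ltn (row_at b g r k) /\ (forall c, V c k = (c \in row_at b g r k)) ->
    forall x, g k = Some x -> x \notin row_at b g r k.
  case=> _ VE x gk; rewrite -VE; apply/negP=> /Vfrom[xr|[k' k'k gk']].
    by have := gN _ _ gk; rewrite xr.
  by have := g_inj _ _ _ gk gk'; lia.
have st k : sorted ltn (row_at b g r k) /\ (forall c, V c k = (c \in row_at b g r k)).
  elim: k => [|k IHk] //; have [r1_s VE] := IHk.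
  have := row_stepP r1_s VE (rowP k IHk) (bN k) (H0 k) (HS^~ k) (VS^~ k).
  by rewrite /=; case: row_step => r' o' [? ? _ _].
move=> k; have [r1_s VE] := st k; split=> // [c|m r_m g_m].
  have := row_stepP r1_s VE (rowP k (st k)) (bN k) (H0 k) (HS^~ k) (VS^~ k).
  by rewrite /out_at; case: row_step => r' o' [_ _ ->].
have row_m j : all (fun c => c < m) (row_at b g r j).
  apply/allP => c; rewrite -(st j).2 => /Vfrom[/(allP r_m)//|[k' _ /g_m]] //.
have := row_stepP r1_s VE (rowP k (st k)) (bN k) (H0 k) (HS^~ k) (VS^~ k).
have := row_m k.+1; rewrite /out_at /=; case: row_step => r' o' r'_m [_ _ _].
by apply.
Qed.

(** The grid is computed from its boundary: [grid_h] advances the time [c] from the initial row [b],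
    and [grid_v] sweeps along [k] within one time, starting from [false] since the carrier starts
    empty. *)
Fixpoint grid_v (p h : nat -> bool) k : bool :=
  if k is k'.+1 then turn (p k') (grid_v p h k') (h k') else false.

Fixpoint grid_h (b : nat -> bool) (g : nat -> option nat) c : nat -> bool :=
  if c is c'.+1 then fun k =>
    turn (g k == Some c') (grid_h b g c' k)
      (grid_v (fun k => g k == Some c') (grid_h b g c') k)
  else b.

(** * Two readings of one grid *)

Section Duality.

Variables (E : seq nat) (f g : nat -> option nat).
Hypotheses (E_sorted : sorted ltn E) (E_g : forall k, k \in E -> g k = None).
Hypothesis fg : forall c k, (f c == Some k) = (g k == Some c).

Let b k := k \in E.
Let H := grid_h b g.
Let V c := grid_v (fun k => g k == Some c) (H c).

Let g_inj k k' x : g k = Some x -> g k' = Some x -> k = k'.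
Proof. by move=> /eqP + /eqP; rewrite -!fg => /eqP-> /eqP[]. Qed.

Let f_inj c c' k : f c = Some k -> f c' = Some k -> c = c'.
Proof. by move=> /eqP + /eqP; rewrite !fg => /eqP-> /eqP[]. Qed.

(** Along [k] the grid is a carrier that starts empty, takes in the entries [g k] and drops at the
    elements of [E]. *)
Let rowG := @grid_row_at b g [::] H V isT (fun _ => erefl) (fun _ => erefl)
  (fun _ _ => erefl) (fun _ _ => erefl) E_g (fun _ _ _ => isT) g_inj.

(** Along [c] the same grid is the insertion of the entries [f c] into the row [E], without
    drops. *)
Let rowF : forall c,
  [/\ sorted ltn (row_at xpred0 f E c),
      forall k, H c k = (k \in row_at xpred0 f E c),
      forall k, (out_at xpred0 f E c == Some k) = [&& f c != Some k, V c k & H c k]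
    & forall m, all (fun k => k < m) E -> (forall c k, f c = Some k -> k < m) ->
        V c m = (isSome (f c) || false) && (out_at xpred0 f E c == None)].
Proof.
apply: (@grid_row_at xpred0 f E (fun k c => V c k) (fun k c => H c k)) => //.
- by move=> k c; rewrite fg.
- by move=> k c; rewrite fg.
- move=> c k /eqP; rewrite fg => /eqP gk; apply/negP=> /E_g.
  by rewrite gk.
Qed.

(** Both sides say that two lines annihilate at the cell [(c, k)], a condition symmetric in the two
    readings. *)
Lemma out_at_dual c k :
  (out_at xpred0 f E c == Some k) = (out_at b g [::] k == Some c).
Proof.
have [_ _ -> _] := rowF c; have [_ _ -> _] := rowG k.
by rewrite fg [V c k && _]andbC.
Qed.

Lemma sorted_row_at_dual c : sorted ltn (row_at xpred0 f E c).
Proof. by case: (rowF c). Qed.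

(** Both sides are [H n k]: the line at [k] survives past all entries exactly when, in the other
    reading, it started there and nothing came out. *)
Lemma mem_row_at_dual n k : (forall k c, g k = Some c -> c < n) ->
  (k \in row_at xpred0 f E n) =
  (isSome (g k) || (k \in E)) && (out_at b g [::] k == None).
Proof.
by move=> g_n; have [_ <- _ _] := rowF n; have [_ _ _ ->] := rowG k.
Qed.

(** A ball left in the carrier is a line that leaves the grid; in the other reading it is an
    insertion that bumped nothing. *)
Lemma row_at_eq_nil N :
    all (fun k => k < N) E -> (forall c k, f c = Some k -> k < N) ->
    (forall c, isSome (f c) -> isSome (out_at xpred0 f E c)) ->
  row_at b g [::] N = [::].
Proof.
move=> E_N f_N f_out; case E1: row_at => [//|c r].
have [_ /(_ c) + _ _] := rowG N; rewrite E1 mem_head.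
have [_ _ _ ->] // := rowF c; rewrite orbF => /andP[/f_out].
by case: out_at.
Qed.

Lemma sorted_row_at k : sorted ltn (row_at b g [::] k).
Proof. by case: (rowG k). Qed.

End Duality.

(** * Symmetry of RSK and the carrier *)

(** Words are held as partial functions of time, so that a letter bumped from row to row keeps its
    time, and hence its label. *)
Definition word (g : nat -> option nat) N : seq nat := pmap g (iota 0 N).

Definition labelled_word (l : nat -> int) (g : nat -> option nat) N :
    seq (int * nat) :=
  pmap (fun k => omap (pair (l k)) (g k)) (iota 0 N).

Lemma pmap_iotaS (T : Type) (h : nat -> option T) N :
  pmap h (iota 0 N.+1) = pmap h (iota 0 N) ++ seq_of_opt (h N).
Proof. by rewrite -addn1 iotaD pmap_cat add0n /=; case: (h N). Qed.

Lemma word_labelled l g N : [seq ia.2 | ia <- labelled_word l g N] = word g N.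
Proof.
by rewrite /labelled_word /word; elim: iota => //= k s <-; case: (g k).
Qed.

Lemma eq_word g1 g2 N : g1 =1 g2 -> word g1 N = word g2 N.
Proof. by move=> g12; apply: eq_pmap. Qed.

Lemma row_run_word r g k :
  row_run r (word g k) = (row_at xpred0 g r k, word (out_at xpred0 g r) k).
Proof.
elim: k => [//|k IHk]; rewrite /word !pmap_iotaS row_run_cat -!/(word _ k) IHk /=.
rewrite /out_at; case: (g k) => [x|] //=.
by case: row_insert => r' o; rewrite cats0.
Qed.

Lemma rsk_P w : (rsk w).1 = tab_of [seq ia.2 | ia <- w].
Proof.
rewrite /rsk /tab_of; move: [::] [::] => t q.
elim: w t q => [//|[i a] w IHw] t q /=.
by rewrite /rsk_step /=; case: tab_insert => t' k; rewrite IHw.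
Qed.

Lemma rsk_from_nil_row w : w != [::] ->
  rsk w = foldl rsk_step ([:: [::]], [:: [::]]) w.
Proof. by case: w => // -[i a] w _. Qed.

(** The later rows see only the letters bumped from the first, at the same times; the first row of Q
    collects the labels of the letters that bump nothing. *)
Lemma rsk_step_row r t q0 q l g k :
  foldl rsk_step (r :: t, q0 :: q) (labelled_word l g k) =
  let: (t', q') :=
    foldl rsk_step (t, q) (labelled_word l (out_at xpred0 g r) k) in
  (row_at xpred0 g r k :: t',
   (q0 ++ [seq l j | j <- iota 0 k
                   & isSome (g j) && (out_at xpred0 g r j == None)]) :: q').
Proof.
elim: k => [|k IHk]; first by rewrite /= cats0.
rewrite /labelled_word !pmap_iotaS !foldl_cat.
rewrite -!/(labelled_word l _ k) IHk.
case: (foldl _ (t, q) _) => t' q'; rewrite -addn1 iotaD filter_cat map_cat catA add0n.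
rewrite addn1 /= /out_at; case: (g k) => [x|] /=; last by rewrite cats0.
rewrite /rsk_step /=; case: row_insert => r' [y|] /=.
  by case: tab_insert => t1 j /=; rewrite cats0.
by rewrite cats1.
Qed.

(** Symmetry of RSK, by induction on the number of rows. In the grid with [E] empty, the words
    bumped in the two readings are again inverse to each other, and [mem_row_at_dual] identifies the
    first rows. *)
Lemma rsk_Q_dual l f g n N :
    (forall c k, (f c == Some k) = (g k == Some c)) ->
    (forall k c, g k = Some c -> c < n) -> (forall c k, f c = Some k -> k < N) ->
  (rsk (labelled_word l g N)).2 = [seq [seq l k | k <- r] | r <- tab_of (word f n)].
Proof.
elim: {f}_.+1 {-2}f g (ltnSn (size (tab_of (word f n)))) => // m IHm f g.
move=> size_f fg g_n f_N.
have fgE c k : f c = Some k -> g k = Some c by move=> /eqP; rewrite fg => /eqP.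
have gfE c k : g k = Some c -> f c = Some k by move=> /eqP; rewrite -fg => /eqP.
have [f0|f_neq0] := eqVneq (word f n) [::].
  have g0 k : g k = None.
    case gk: (g k) => [c|] //; have : k \in word f n.
      rewrite mem_pmap; apply/mapP; exists c; last by rewrite (gfE c k).
      by rewrite mem_iota (g_n k).
    by rewrite f0.
  rewrite f0 /labelled_word.
  by rewrite (_ : pmap _ _ = [::]) //; elim: iota => //= k s ->; rewrite g0.
have g_neq0 : labelled_word l g N != [::].
  apply: contra f_neq0 => /eqP g0; have {}g0 : word g N = [::].
    by rewrite -(word_labelled l) g0.
  case f1: (word f n) => [//|k w]; have : k \in word f n by rewrite f1 mem_head.
  rewrite mem_pmap => /mapP[c _ /esym fc]; have : c \in word g N.
    rewrite mem_pmap; apply/mapP; exists k; last by rewrite (fgE c k).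
    by rewrite mem_iota (f_N c).
  by rewrite g0.
have E_g k : k \in [::] -> g k = None by [].
have out_fg := @out_at_dual [::] f g isT E_g fg.
move: size_f; rewrite (tab_of_row_run f_neq0) row_run_word ltnS => size_f.
rewrite (rsk_from_nil_row g_neq0) rsk_step_row /=.
have {IHm} := IHm (out_at xpred0 f [::]) (out_at xpred0 g [::]) size_f out_fg.
rewrite /rsk; case: (foldl _ _ _) => t' q' /= -> //; first last.
- move=> c k /eqP; rewrite out_fg /out_at.
  by case gk: (g k) => [c'|//] _; apply: (f_N c'); apply: gfE.
- move=> k c /eqP; rewrite -out_fg /out_at.
  by case fc: (f c) => [k'|//] _; apply: (g_n k'); apply: fgE.
congr (map l _ :: _); apply: (irr_sorted_eq ltn_trans ltnn).
- by apply: sorted_filter; [apply: ltn_trans|apply: iota_ltn_sorted].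
- exact: (@sorted_row_at_dual [::] f g isT E_g fg).
move=> k; rewrite (@mem_row_at_dual [::] f g isT E_g fg) //.
rewrite mem_filter mem_iota /= orbF.
case gk: (g k) => [c|] //=; rewrite (f_N c k) ?andbT //; exact: gfE.
Qed.

(** At a ball this is [knuth_row_insert]; at an empty box the carrier word is merely cut after its
    first letter. *)
Lemma knuth_carrier b g k : (forall j, sorted leq (row_at b g [::] j)) ->
  knuth (word g k) (word (out_at b g [::]) k ++ row_at b g [::] k).
Proof.
move=> rows; elim: k => [|k IHk]; first exact: knuth_refl.
rewrite /word !pmap_iotaS.
apply: knuth_trans (knuth_catr _ IHk) _; rewrite -!catA; apply: knuth_catl.
rewrite /= /out_at; case: (g k) => [x|] /=.
  by rewrite cats1; apply: knuth_row_insert.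
rewrite cats0; case: (b k) => /=; last exact: knuth_refl.
by case: row_at => [|y r]; apply: knuth_refl.
Qed.

(** Colors start at 1, so time 0 is idle and a word [p] occupies the times 1 to [size p]. *)
Definition box_at_color (p : seq nat) (c : nat) : option nat :=
  if c is c'.+1 then onth p c' else None.

Definition color_in_box (p : seq nat) (k : nat) : option nat :=
  if k \in p then Some (index k p).+1 else None.

Lemma box_color_inverse p : uniq p -> forall c k,
  (box_at_color p c == Some k) = (color_in_box p k == Some c).
Proof.
move=> p_uniq [|c] k; rewrite /color_in_box; first by case: ifP.
rewrite /=; apply/eqP/idP => [pc|].
  have kp : k \in p by apply/onthP; exists c.
  have cp : c < size p by rewrite -onthTE pc.
  by rewrite kp -(onth_nth 0 _ _ _ pc) eq_SomeE eqSS index_uniq.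
case: ifP => // kp /eqP[<-].
by rewrite onthE (nth_map 0) ?index_mem // nth_index.
Qed.

Lemma box_at_color_mem p c k : box_at_color p c = Some k -> k \in p.
Proof. by case: c => //= c pc; apply/onthP; exists c. Qed.

Lemma color_in_box_lt p k c : color_in_box p k = Some c -> c < (size p).+1.
Proof. by rewrite /color_in_box; case: ifP => // kp [<-]; rewrite ltnS index_mem. Qed.

Lemma word_box_at_color p : word (box_at_color p) (size p).+1 = p.
Proof.
have shift (h : nat -> option nat) m : pmap h (iota 1 m) = word (h \o S) m.
  by rewrite (iotaDl 1 0) /word; elim: (iota 0 m) => //= k s ->.
rewrite /word /= shift; elim: p => //= x p IHp.
by rewrite /word /= shift [word _ _]IHp.
Qed.

Lemma labelled_word_color_in_box l p N :
  labelled_word l (color_in_box p) N =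
  [seq (l k, (index k p).+1) | k <- iota 0 N & k \in p].
Proof.
rewrite /labelled_word; elim: iota => //= k s ->.
by rewrite /color_in_box; case: (k \in p).
Qed.

(** * Box-ball states *)

Section States.

Variables (n N : nat) (L : int).

(** In a finite window boxes are named by their offset from [L], which makes them natural numbers as
    the grid requires. *)
Definition in_window (s : state n) : Prop :=
  forall c, (L <= s c < L + N%:Z)%R.

(** The word of the boxes in color order. Inside the window the offsets are nonnegative and the
    absolute value changes nothing. *)
Definition positions (s : state n) : seq nat :=
  [seq `|(s c - L)%R|%N | c <- enum 'I_n].

Implicit Types (s : state n) (c : 'I_n).

Lemma size_positions s : size (positions s) = n.
Proof. by rewrite size_map size_enum_ord. Qed.

Lemma nth_positions s c : nth 0 (positions s) c = `|(s c - L)%R|%N.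
Proof. by rewrite (nth_map c) ?size_enum_ord // nth_ord_enum. Qed.

Lemma onth_positions s c :
  onth (positions s) c = Some `|(s c - L)%R|%N.
Proof. by rewrite onthE (nth_map 0) ?size_positions // nth_positions. Qed.

Lemma state_inj s : injective s.
Proof. exact/injectiveP/box_of_inj. Qed.

Lemma position_box s c : in_window s -> (L + `|(s c - L)%R|%N%:Z)%R = s c.
Proof. by move/(_ c); lia. Qed.

Lemma codom_positions s : in_window s ->
  codom s = [seq (L + k%:Z)%R | k <- positions s].
Proof.
move=> sW; rewrite codomE /positions -map_comp.
by apply/esym/eq_map => c /=; apply: position_box.
Qed.

Lemma positions_uniq s : in_window s -> uniq (positions s).
Proof.
move=> sW; have : uniq (codom s) by rewrite map_inj_uniq ?enum_uniq //; apply: state_inj.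
by rewrite codom_positions //; apply: map_uniq.
Qed.

Lemma positions_lt s : in_window s -> forall k, k \in positions s -> k < N.
Proof. by move=> sW k /mapP[c _ ->]; have := sW c; lia. Qed.

Lemma label_inj : injective (fun k : nat => (L + k%:Z)%R).
Proof. by move=> k k'; lia. Qed.

Lemma mem_label (k : nat) p :
  ((L + k%:Z)%R \in [seq (L + k%:Z)%R | k : nat <- p]) = (k \in p).
Proof. exact: (mem_map label_inj). Qed.

Lemma biword_labelled s : in_window s ->
  biword s =
    labelled_word (fun k => (L + k%:Z)%R) (color_in_box (positions s)) N.
Proof.
move=> sW; rewrite labelled_word_color_in_box /biword.
have -> : sort (fun i j : int => (i <= j)%R) (codom s) =
    [seq (L + k%:Z)%R | k <- iota 0 N & k \in positions s].
  rewrite codom_positions //; apply: (@sorted_eq _ (fun i j : int => (i <= j)%R)).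
  - by move=> ? ? ?; lia.
  - by move=> ? ?; lia.
  - by apply: sort_sorted => ? ?; lia.
  - rewrite sorted_map; apply: sorted_filter; first by move=> ? ? ? /=; lia.
    by apply: sub_sorted (iota_ltn_sorted 0 N) => ? ? /=; lia.
  rewrite perm_sort; apply/perm_map/uniq_perm.
  - exact: positions_uniq.
  - by rewrite filter_uniq ?iota_uniq.
  move=> k; rewrite mem_filter mem_iota; case kp: (k \in _) => //=.
  by rewrite (positions_lt sW).
rewrite -map_comp; apply: eq_map => k /=; congr (_, _).
by rewrite /color_at codom_positions // (index_map label_inj).
Qed.

Lemma P_symbol_positions s : in_window s ->
  P_symbol s = tab_of (word (color_in_box (positions s)) N).
Proof. by move=> sW; rewrite /P_symbol biword_labelled // rsk_P word_labelled. Qed.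

(** The bi-word lists colors by box, the inverse of listing boxes by color, so the symmetry of RSK
    turns its Q-symbol into an insertion tableau. *)
Lemma Q_symbol_positions s : in_window s ->
  Q_symbol s = [seq [seq (L + k%:Z)%R | k : nat <- r] | r <- tab_of (positions s)].
Proof.
move=> sW; rewrite /Q_symbol biword_labelled //.
rewrite (@rsk_Q_dual _ (box_at_color (positions s)) _ n.+1).
- by have := word_box_at_color (positions s); rewrite size_positions => ->.
- exact/box_color_inverse/positions_uniq.
- by move=> k c /color_in_box_lt; rewrite size_positions.
- by move=> c k /box_at_color_mem; apply: positions_lt.
Qed.

Definition empty_boxes s : seq nat :=
  [seq k <- iota 0 N | ~~ occupied s (L + k%:Z)%R].

Lemma empty_boxes_sorted s : sorted ltn (empty_boxes s).
Proof. by apply: sorted_filter; [apply: ltn_trans|apply: iota_ltn_sorted]. Qed.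

Lemma mem_empty_boxes s k :
  (k \in empty_boxes s) = ~~ occupied s (L + k%:Z)%R && (k < N).
Proof. by rewrite mem_filter mem_iota. Qed.

Lemma empty_boxesE s : in_window s ->
  empty_boxes s = [seq k <- iota 0 N | k \notin positions s].
Proof.
by move=> sW; apply: eq_filter => k; rewrite /occupied codom_positions // mem_label.
Qed.

Lemma occupied_move s c i : occupied (move s c) i =
  (i == nearest_empty s (s c)) || occupied s i && (i != s c).
Proof.
apply/codomP/orP => [[d ->]|[/eqP->|/andP[/codomP[d ->] dc]]].
- rewrite ffunE; case: (eqVneq d c) => [_|dc]; [by left|right].
  by rewrite /occupied codom_f (inj_eq (@state_inj s)).
- by exists c; rewrite ffunE eqxx.
- by exists d; rewrite ffunE; case: (eqVneq d c) dc => [->|//]; rewrite eqxx.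
Qed.

(* Moving a ball amounts to inserting its box into the row of the empty boxes. *)
Lemma row_insert_move s c (x y : nat) :
    s c = (L + x%:Z)%R -> x < N ->
    nearest_empty s (s c) = (L + y%:Z)%R -> y < N ->
  row_insert x (empty_boxes s) = (empty_boxes (move s c), Some y).
Proof.
move=> sx xN sy yN; have [xy yE yP] := nearest_emptyP s (s c).
rewrite sy in yE yP xy; rewrite sx in yP xy.
apply: row_insert_eq; rewrite ?empty_boxes_sorted ?mem_empty_boxes //.
- by rewrite /occupied -sx codom_f.
- by rewrite yE.
- by lia.
- move=> z; rewrite mem_empty_boxes => /andP[zE zN] xz; rewrite leqNgt.
  by apply: contra zE => zy; apply: yP; lia.
move=> z; rewrite !mem_empty_boxes occupied_move sy sx.
rewrite !(inj_eq (@GRing.addrI _ L)) !eqz_nat; case: (eqVneq z x) => [->|zx] /=.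
  by rewrite xN andbF orbF andbT; lia.
by rewrite andbT; case: (z == y); rewrite ?andbF //= andbT.
Qed.

(** * One time step as the insertion of the box word *)

Lemma foldl_move_notin s (cs : seq 'I_n) c :
  c \notin cs -> foldl (@move n) s cs c = s c.
Proof.
elim: cs s => //= d cs IH s; rewrite inE negb_or => /andP[cd /IH->].
by rewrite ffunE (negbTE cd).
Qed.

Definition partial_step s m := foldl (@move n) s (take m (enum 'I_n)).

Lemma mem_take_enum m c : (c \in take m (enum 'I_n)) = (c < m).
Proof.
rewrite -(mem_map val_inj) map_take val_enum_ord take_iota mem_iota /= add0n.
by have := ltn_ord c; lia.
Qed.

Lemma mem_drop_enum m c : (c \in drop m (enum 'I_n)) = (m <= c).
Proof.
rewrite -(mem_map val_inj) map_drop val_enum_ord drop_iota mem_iota /= add0n.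
by have := ltn_ord c; lia.
Qed.

Lemma partial_step_unmoved s m c : m <= c -> partial_step s m c = s c.
Proof. by move=> mc; apply: foldl_move_notin; rewrite mem_take_enum -leqNgt. Qed.

Lemma partial_step_moved s m c : c < m -> partial_step s m c = bbs_step s c.
Proof.
move=> cm; rewrite /bbs_step -[in RHS](cat_take_drop m (enum 'I_n)) foldl_cat.
by rewrite [RHS]foldl_move_notin // mem_drop_enum -ltnNge.
Qed.

Lemma partial_stepS s c : partial_step s c.+1 = move (partial_step s c) c.
Proof.
rewrite /partial_step (take_nth c) ?size_enum_ord // nth_ord_enum.
by rewrite -cats1 foldl_cat.
Qed.

Lemma nearest_empty_partial_step s c :
  nearest_empty (partial_step s c) (partial_step s c c) = bbs_step s c.
Proof.
by rewrite -(@partial_step_moved s c.+1) // partial_stepS ffunE eqxx.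
Qed.

Lemma row_insert_partial_step s c : in_window s -> in_window (bbs_step s) ->
  row_insert (nth 0 (positions s) c) (empty_boxes (partial_step s c)) =
  (empty_boxes (partial_step s c.+1), Some (nth 0 (positions (bbs_step s)) c)).
Proof.
move=> sW tW; rewrite partial_stepS !nth_positions; apply: row_insert_move.
- by rewrite partial_step_unmoved // position_box.
- by have := sW c; lia.
- by rewrite nearest_empty_partial_step position_box.
- by have := tW c; lia.
Qed.

(** The shift to [m.+1] accounts for the idle time 0: the ball with index [m] has color [m.+1]. *)
Lemma row_at_step s m : in_window s -> in_window (bbs_step s) -> m <= n ->
  row_at xpred0 (box_at_color (positions s)) (empty_boxes s) m.+1 =
  empty_boxes (partial_step s m).
Proof.
move=> sW tW; elim: m => [_|m IHm mn]; first by rewrite /= /partial_step take0.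
have := row_insert_partial_step (Ordinal mn) sW tW; rewrite nth_positions /=.
move: IHm => /(_ (ltnW mn)) /= ->.
by rewrite (onth_positions s (Ordinal mn)) /= => ->.
Qed.

Lemma out_at_step s : in_window s -> in_window (bbs_step s) ->
  out_at xpred0 (box_at_color (positions s)) (empty_boxes s) =1
  box_at_color (positions (bbs_step s)).
Proof.
move=> sW tW [|c] //; rewrite /out_at; have [cn|nc] := ltnP c n; last first.
  by rewrite /= !onth_default ?size_positions.
rewrite row_at_step ?(ltnW cn) //= (onth_positions _ (Ordinal cn)) /=.
have := row_insert_partial_step (Ordinal cn) sW tW.
by rewrite !nth_positions /= => ->; rewrite (onth_positions _ (Ordinal cn)).
Qed.

Lemma P_symbol_step s : in_window s -> in_window (bbs_step s) ->
  P_symbol (bbs_step s) = P_symbol s.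
Proof.
move=> sW tW; rewrite !P_symbol_positions //; set p := positions s.
set q := positions (bbs_step s); set E := empty_boxes s.
have E_s : sorted ltn E by apply: empty_boxes_sorted.
have E_g k : k \in E -> color_in_box p k = None.
  by rewrite /E empty_boxesE // mem_filter /color_in_box => /andP[/negbTE->].
have fg := box_color_inverse (positions_uniq sW).
(* The carrier writes exactly the new state: by duality both sides are inverse to the map from
   colors to bumped boxes. *)
have gq k : color_in_box q k =
    out_at (fun k => k \in E) (color_in_box p) [::] k.
  have out_fg (c : nat) := out_at_dual E_s E_g fg c k.
  have fq (c : nat) := box_color_inverse (positions_uniq tW) c k.
  have {}out_fg (c : nat) : (color_in_box q k == Some c) =
      (out_at (fun k => k \in E) (color_in_box p) [::] k == Some c).
    by rewrite -fq -out_fg (out_at_step sW tW).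
  case q1: (color_in_box q k) (out_fg) => [c|] o1.
    by have := o1 c; rewrite eqxx => /esym/eqP.
  by case o2: out_at o1 => [c|//] /(_ c); rewrite eqxx.
apply/esym/knuth_tab_of; rewrite (eq_word N gq).
have := @knuth_carrier (fun k => k \in E) (color_in_box p) N.
(* The carrier is empty at the end of the window because every ball finds an empty box there. *)
rewrite (row_at_eq_nil E_s E_g fg) ?cats0; first apply.
- move=> j; have := sorted_row_at E_g fg j.
  by apply: sub_sorted => ? ?; apply: ltnW.
- by apply/allP => k; rewrite mem_empty_boxes => /andP[].
- by move=> c k /box_at_color_mem /(positions_lt sW).
- move=> c; rewrite (out_at_step sW tW); case: c => //= c.
  by rewrite !onthTE !size_positions.
Qed.

Lemma positions_step s : in_window s -> in_window (bbs_step s) ->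
  (row_run (empty_boxes s) (positions s)).2 = positions (bbs_step s).
Proof.
move=> sW tW; rewrite -{1}(word_box_at_color (positions s)) row_run_word /=.
rewrite (eq_word _ (out_at_step sW tW)) size_positions.
by have := word_box_at_color (positions (bbs_step s)); rewrite size_positions.
Qed.

Lemma Q_symbol_step (s1 s2 : state n) :
    in_window s1 -> in_window s2 ->
    in_window (bbs_step s1) -> in_window (bbs_step s2) ->
  Q_symbol s1 = Q_symbol s2 -> Q_symbol (bbs_step s1) = Q_symbol (bbs_step s2).
Proof.
move=> s1W s2W t1W t2W; rewrite !Q_symbol_positions //.
move=> /(inj_map (inj_map label_inj)) /knuth_tab_of p12; congr (map _ _).
apply/knuth_tab_of; rewrite -(positions_step s1W t1W) -(positions_step s2W t2W).
(* Knuth equivalent words are rearrangements of each other, so both states occupy the same boxes and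
   insert into the same row. *)
have -> : empty_boxes s1 = empty_boxes s2.
  rewrite !empty_boxesE //; apply: eq_filter => k.
  by rewrite (perm_mem (knuth_perm p12)).
apply: (knuth_row_run p12 _).2; have := empty_boxes_sorted s2.
by apply: sub_sorted => ? ?; apply: ltnW.
Qed.

End States.

(** A common window is needed, since the states compared must share [L] and [N]. *)
Lemma exists_window n (ss : seq (state n)) :
  exists L N, forall s, s \in ss -> in_window N L s.
Proof.
pose M := \max_(s <- ss) \max_c `|s c|%N.
(* The boxes from [-M] to [M], hence [2M + 1] of them. *)
exists (- M%:Z)%R, (M + M).+1 => s s_ss c.
have : `|s c|%N <= M.
  apply: (leq_trans (leq_bigmax (F := fun c => `|s c|%N) c)).
  exact: (leq_bigmax_seq (F := fun s : state n => \max_c `|s c|%N)).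
by lia.
Qed.

Theorem theorem3p1 (n : nat) (hn : 1 <= n) :
  (forall s : state n, P_symbol (bbs_step s) = P_symbol s) /\
  (forall s1 s2 : state n, Q_symbol s1 = Q_symbol s2 ->
     Q_symbol (bbs_step s1) = Q_symbol (bbs_step s2)).
Proof.
split=> [s|s1 s2].
  have [L [N ssW]] := exists_window [:: s; bbs_step s].
  by apply: (@P_symbol_step n N L); apply: ssW; rewrite !inE eqxx ?orbT.
have [L [N ssW]] := exists_window [:: s1; s2; bbs_step s1; bbs_step s2].
by apply: (@Q_symbol_step n N L); apply: ssW; rewrite !inE eqxx ?orbT.
Qed.
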